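(* Let $u$ be a solution of $$(i\partial_t+\Delta_{\mathbb{R}\times\mathbb{T}^3})u=-|u|^2u,\qquad u(0)=u_0\in H^1(\mathbb{R}\times\mathbb{T}^3),$$ and let $I\ni0$ be its maximal interval of existence. All norms without indicated domain are over $\mathbb{R}\times\mathbb{T}^3$. Part (i). Suppose that for some $\delta_0>0$, $$\|u_0\|_{H^1_*}<\|W\|_{\dot H^1(\mathbb{R}^4)},\qquad E_*(u_0)<(1-\delta_0)E_{\mathbb{R}^4}(W).$$ Then there exists $\bar\delta=\bar\delta(\delta_0)>0$ such that for all $t\in I$ $$\|u(t)\|^2_{H^1_*}<(1-\bar\delta)\|W\|^2_{\dot H^1(\mathbb{R}^4)},\qquad \|u(t)\|_{H^1_*}^2-\|u(t)\|_{L^4}^4\ge\bar\delta\|u(t)\|^2_{H^1_*},$$ and in particular $E_*(u(t))\ge\frac14(1+\bar\delta)\|u(t)\|_{H^1_*}^2$. Part (ii). Suppose that for some $\delta_0>0$, $$\|u_0\|_{\dot H^1}<\|W\|_{\dot H^1(\mathbb{R}^4)},\qquad E_{**}(u_0)<(1-\delta_0)E_{\mathbb{R}^4}(W).$$ Then there exists $\bar\delta=\bar\delta(\delta_0)>0$ such that for all $t\in I$ $$\|u(t)\|^2_{\dot H^1}<(1-\bar\delta)\|W\|^2_{\dot H^1(\mathbb{R}^4)},$$ $$\|u(t)\|_{\dot H^1}^2-\|u(t)\|_{L^4}^4+2c_*\|u(t)\|_{L^2}^2+c_*^2C_4^4\|u(t)\|_{L^2}^4\ge\bar\delta\|u(t)\|^2_{\dot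 H^1},$$ and in particular $E_{**}(u(t))\ge\frac14(1+\bar\delta)\|u(t)\|_{\dot H^1}^2$.
   Context: $\mathbb{T}=\mathbb{R}/2\pi\mathbb{Z}$, $\|f\|_{\dot H^1}=\|\nabla f\|_{L^2}$. $W(x)=(1+|x|^2/8)^{-1}$ on $\mathbb{R}^4$, which satisfies $\Delta W=-|W|^2W$; $E_{\mathbb{R}^4}(f)=\int_{\mathbb{R}^4}\frac12|\nabla f|^2-\frac14|f|^4\,dx$. $C_4$ is the best constant in $\|f\|_{L^4(\mathbb{R}^4)}\le C_4\|\nabla f\|_{L^2(\mathbb{R}^4)}$, so $\|W\|^2_{\dot H^1(\mathbb{R}^4)}=\|W\|^4_{L^4(\mathbb{R}^4)}=C_4^{-4}$ and $E_{\mathbb{R}^4}(W)=\frac14C_4^{-4}$. $c_*>0$ is a fixed constant such that for all $f\in H^1(\mathbb{R}\times\mathbb{T}^3)$, $\|f\|^2_{L^4}\le C_4^2(\|f\|^2_{\dot H^1}+c_*\|f\|^2_{L^2})$. With all norms on $\mathbb{R}\times\mathbb{T}^3$, $$\|f\|^2_{H^1_*}=\|f\|^2_{\dot H^1}+c_*\|f\|_{L^2}^2,\quad E_*(f)=\tfrac12\|f\|_{H^1_*}^2-\tfrac14\|f\|_{L^4}^4,\quad E_{**}(f)=E_*(f)+\tfrac{c_*^2C_4^4}{4}\|f\|_{L^2}^4 .$$ Solutions are strong solutions, continuous in time with values in $H^1(\mathbb{R}\times\mathbb{T}^3)$, conserving the mass $\int|u|^2$ and the energy $\int\frac12|\nabla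 u|^2-\frac14|u|^4$. *)

(* Defs.v *)
From HB Require Import structures.
From mathcomp Require Import all_boot all_order all_algebra.
From mathcomp Require Import all_classical all_reals all_analysis.
From mathcomp Require Import complex.

Set Implicit Arguments.
Unset Strict Implicit.
Unset Printing Implicit Defensive.

Import Order.TTheory GRing.Theory Num.Theory.
Import numFieldNormedType.Exports.

Local Open Scope classical_set_scope.
Local Open Scope ring_scope.
Local Open Scope complex_scope.

(* Points of R^4.  A function on R x T^3, T = R / 2 pi Z, is represented by its
   values on the cell R x [0, 2 pi[^3 (see [muRT3] and [testRT3]). *)
Notation R4 R := (R * R * R * R)%type.

(* The same type, with the sigma-algebra on which [lebesgue_measure] lives. *)
Notation MR4 R := (measurableTypeR R * measurableTypeR R * measurableTypeR R
                   * measurableTypeR R)%type.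

Section Calculus.
Context {R : realType}.
Implicit Types (x : R4 R) (j : 'I_4) (phi : R4 R -> R).

Definition unitvec j : R4 R :=
  ((j == 0 :> nat)%:R, (j == 1 :> nat)%:R,
   (j == 2 :> nat)%:R, (j == 3 :> nat)%:R).

Definition sqnorm x : R :=
  x.1.1.1 ^+ 2 + x.1.1.2 ^+ 2 + x.1.2 ^+ 2 + x.2 ^+ 2.

Definition partial j phi : R4 R -> R := fun x => 'D_(unitvec j) phi x.

Definition laplacian phi : R4 R -> R :=
  fun x => \sum_(j < 4) partial j (partial j phi) x.

Definition smooth phi :=
  forall (s : seq 'I_4) x, differentiable (foldr partial phi s) x.

(* C_c^oo(R^4) *)
Definition testR4 : set (R4 R -> R) := [set phi |
  smooth phi /\ exists M : R, forall x, M < sqnorm x -> phi x = 0].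

(* C_c^oo(R x T^3): 2 pi-periodic in the last three variables.  The periodicity
   of the test functions is what makes the weak derivatives below those of the
   torus, with no boundary terms on the faces of the cell. *)
Definition testRT3 : set (R4 R -> R) := [set phi |
  [/\ smooth phi,
      forall x j, j != ord0 -> phi (x + (pi *+ 2) *: unitvec j) = phi x &
      exists M : R, forall x, M < `|x.1.1.1| -> phi x = 0]].

Definition leb4 : {measure set (MR4 R) -> \bar R} :=
  (((@lebesgue_measure R \x @lebesgue_measure R) \x @lebesgue_measure R)
     \x @lebesgue_measure R)%E.

Definition cell : set (MR4 R) :=
  setT `*` `[0, pi *+ 2[ `*` `[0, pi *+ 2[ `*` `[0, pi *+ 2[.

Lemma measurable_cell : measurable cell.
Proof. by do 3 apply: measurableX => //. Qed.

Definition muRT3 : {measure set (MR4 R) -> \bar R} := mrestr leb4 measurable_cell.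

End Calculus.

Section Norms.
Context {R : realType}.
Variable mu : {measure set (MR4 R) -> \bar R}.
Implicit Types (f : R4 R -> R[i]) (g : 'I_4 -> R4 R -> R[i]).

Definition cmeasurable f :=
  measurable_fun [set: MR4 R] (fun x => complex.Re (f x)) /\
  measurable_fun [set: MR4 R] (fun x => complex.Im (f x)).

Definition LpNorm (p : R) f : \bar R :=
  Lnorm mu p%:E (fun x => (Normc.normc (f x))%:E).

Definition Lp (p : R) f := cmeasurable f /\ (LpNorm p f < +oo)%E.

Definition gradmod g (x : R4 R) : R :=
  Num.sqrt (\sum_(j < 4) Normc.normc (g j x) ^+ 2).

Definition gradNorm g : R := fine (Lnorm mu 2%:E (fun x => (gradmod g x)%:E)).

Definition mass_of f : R := \int[mu]_x (Normc.normc (f x) ^+ 2).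

Definition energy_of f g : R :=
  \int[mu]_x (gradmod g x ^+ 2 / 2 - Normc.normc (f x) ^+ 4 / 4).

Definition weak_partial (T : set (R4 R -> R)) (j : 'I_4) (f g : R4 R -> R) :=
  forall phi, T phi ->
    \int[mu]_x (f x * partial j phi x) = - \int[mu]_x (g x * phi x).

Definition pairing f (phi : R4 R -> R) : R[i] :=
  (\int[mu]_x (complex.Re (f x) * phi x))
    +i* (\int[mu]_x (complex.Im (f x) * phi x)).

End Norms.

(* Functions in L^p whose weak gradient, with respect to the test functions T,
   is in L^2.  The gradient, which is determined almost everywhere by the
   function, is kept as a component. *)
Record sobolev (R : realType) (mu : {measure set (MR4 R) -> \bar R})
    (T : set (R4 R -> R)) (p : R) := Sobolev {
  sob_fun :> R4 R -> R[i];
  sob_grad : 'I_4 -> R4 R -> R[i];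
  sob_fun_Lp : Lp mu p sob_fun;
  sob_grad_L2 : forall j, Lp mu 2 (sob_grad j);
  sob_weak_Re : forall j, weak_partial mu T j
    (fun x => complex.Re (sob_fun x)) (fun x => complex.Re (sob_grad j x));
  sob_weak_Im : forall j, weak_partial mu T j
    (fun x => complex.Im (sob_fun x)) (fun x => complex.Im (sob_grad j x)) }.

(* Since C_c^oo is dense in it, this is the homogeneous space \dot H^1(R^4);
   membership in L^4 excludes the nonzero constants. *)
Definition dotH1R4 (R : realType) := sobolev (@leb4 R) (@testR4 R) 4.

Definition H1 (R : realType) := sobolev (@muRT3 R) (@testRT3 R) 2.

Section GroundState.
Context {R : realType}.

Definition W (x : R4 R) : R := (1 + sqnorm x / 8)^-1.

Definition Wc (x : R4 R) : R[i] := (W x)%:C.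

Definition gradW (j : 'I_4) (x : R4 R) : R[i] := (partial j W x)%:C.

Definition W_dotH1 : R := gradNorm leb4 gradW.

Definition W_L4 : R := fine (LpNorm leb4 4 Wc).

Definition W_energy : R := energy_of leb4 Wc gradW.

Definition sobolev_constant (C : R) := forall f : dotH1R4 R,
  (LpNorm leb4 4 f <= (C * gradNorm leb4 (sob_grad f))%:E)%E.

Definition best_sobolev_constant (C : R) :=
  sobolev_constant C /\ forall C', sobolev_constant C' -> C <= C'.

End GroundState.

Section Functionals.
Context {R : realType}.
Implicit Types f g : H1 R.

Definition L2 f : R := fine (LpNorm muRT3 2 f).

Definition L4 f : R := fine (LpNorm muRT3 4 f).

Definition dotH1 f : R := gradNorm muRT3 (sob_grad f).

Definition mass f : R := mass_of muRT3 f.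

Definition energy f : R := energy_of muRT3 f (sob_grad f).

Definition H1star (c : R) f : R := Num.sqrt (dotH1 f ^+ 2 + c * L2 f ^+ 2).

Definition Estar (c : R) f : R := H1star c f ^+ 2 / 2 - L4 f ^+ 4 / 4.

Definition Estarstar (C4 c : R) f : R :=
  Estar c f + c ^+ 2 * C4 ^+ 4 / 4 * L2 f ^+ 4.

(* The left-hand side is an extended real, so that the inequality contains
   the embedding of H^1 into L^4. *)
Definition H1_L4_bound (C4 c : R) := forall f,
  (LpNorm muRT3 4 f ^+ 2 <=
     (C4 ^+ 2 * (dotH1 f ^+ 2 + c * L2 f ^+ 2))%:E)%E.

Definition H1dist f g : R := Num.sqrt
  (fine (LpNorm muRT3 2 (fun x => f x - g x)) ^+ 2
   + gradNorm muRT3 (fun j x => sob_grad f j x - sob_grad g j x) ^+ 2).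

End Functionals.

Section Solutions.
Context {R : realType}.
Implicit Types (I : set R) (u : R -> H1 R).

Definition is_cderive (F : R -> R[i]) (t : R) (z : R[i]) :=
  is_derive t 1 (fun s => complex.Re (F s)) (complex.Re z) /\
  is_derive t 1 (fun s => complex.Im (F s)) (complex.Im z).

(* i u_t + Delta u = - |u|^2 u at time t, as an identity of distributions on
   R x T^3; real test functions suffice by linearity. *)
Definition nls_at u (t : R) := forall phi, testRT3 phi -> exists z : R[i],
  is_cderive (fun s => pairing muRT3 (u s) phi) t z /\
  (0 +i* 1) * z + pairing muRT3 (u t) (laplacian phi) =
    - pairing muRT3 (fun x => (Normc.normc (u t x) ^+ 2)%:C * u t x) phi.

(* Values of u outside I are irrelevant. *)
Definition is_solution I u :=
  [/\ open I /\ is_interval I, I 0,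
      forall t, I t -> (fun s => H1dist (u s) (u t)) @ t --> (0 : R),
      forall t, I t -> nls_at u t &
      forall t, I t -> mass (u t) = mass (u 0) /\ energy (u t) = energy (u 0)].

Definition is_maximal_solution (u0 : H1 R) I u :=
  [/\ is_solution I u,
      H1dist (u 0) u0 = 0 &
      forall J v, is_solution J v -> I `<=` J ->
        (forall t, I t -> H1dist (v t) (u t) = 0) -> J = I].

End Solutions.

(* Main.v *)
Require Import Defs.
From HB Require Import structures.
From mathcomp Require Import all_boot all_order all_algebra.
From mathcomp Require Import all_classical all_reals all_analysis.
From mathcomp Require Import measurable_realfun complex ring lra.
Import Order.TTheory GRing.Theory Num.Theory.
Import numFieldNormedType.Exports.
Local Open Scope classical_set_scope.
Local Open Scope ring_scope.

(** Put [K = C4 ^ 4], so that [K^-1] is the squared norm of [W] and [K^-1 / 4]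
    its energy.  Let [y t] be the squared [H1star] norm of [u t] in part (i), its
    squared [dotH1] norm in part (ii).  The embedding into L^4 bounds the conserved
    energy from below by [y / 2 - K * y ^ 2 / 4] (in part (ii), only as long as
    [K * y <= 1]: the L^2 terms left over are a positive multiple of
    [1 - K * y]).  An energy below [(1 - delta0) * K^-1 / 4] then means
    [delta0 < (1 - K * y) ^ 2], so the continuous function [K * y], which starts
    below 1, never takes the value 1, and it stays below [1 - sqrt delta0].
    Everything else follows algebraically, with [delta = sqrt delta0].

    If [C4 = 0] then [C4 ^- 4 = 0], [W_dotH1 = 0] and the assumption on [u0] is
    void; otherwise the nonzero values in [hW] force the norms of [W], as extended
    reals, to be finite, since [fine +oo = 0]. *)

(** * Real L^p norms on a measure space: powers, triangle inequalities, null functions *)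

Section Lnorm.
Context d (T : measurableType d) (R : realType).
Variable mu : {measure set T -> \bar R}.
Implicit Types f g h : T -> R.

Local Notation N p f := (Lnorm mu p%:E (fun x => (f x)%:E)).

Lemma Lnorm_powE (n : nat) f : (0 < n)%N ->
  (N n%:R f `^ n%:R = \int[mu]_x (`|f x| ^+ n)%:E)%E.
Proof.
move=> n0; rewrite poweR_Lnorm ?pnatr_eq0 -?lt0n//.
by apply: eq_integral => x _; rewrite poweR_EFin powR_mulrn.
Qed.

Lemma fine_Lnorm_exprn (n : nat) f : (0 < n)%N ->
  fine (N n%:R f) ^+ n = \int[mu]_x (`|f x| ^+ n).
Proof.
move=> n0; rewrite /Rintegral -Lnorm_powE// fine_poweR powR_mulrn//.
exact/fine_ge0/Lnorm_ge0.
Qed.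

Lemma Lnorm_lty_integrable (n : nat) f : (0 < n)%N ->
  measurable_fun [set: T] f ->
  (N n%:R f < +oo)%E -> mu.-integrable [set: T] (fun x => (`|f x| ^+ n)%:E).
Proof.
move=> n0 mf foo; apply/integrableP; split.
  by apply/measurable_EFinP/measurable_funX/measurableT_comp.
under eq_integral do rewrite gee0_abs ?lee_fin ?exprn_ge0//.
by rewrite -Lnorm_powE// poweR_lty.
Qed.

Lemma measurable_norm_powR (p : R) f : measurable_fun [set: T] f ->
  measurable_fun [set: T] (fun x => (`|(f x)%:E| `^ p)%E).
Proof.
move=> mf; apply/measurable_EFinP.
apply: (@measurableT_comp _ _ _ _ _ _ (@powR R ^~ p)) => //.
exact: measurableT_comp.
Qed.

Lemma le_Lnorm (p : R) f g : 0 < p ->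
  measurable_fun [set: T] f -> measurable_fun [set: T] g ->
  (forall x, `|f x| <= `|g x|) -> (N p f <= N p g)%E.
Proof.
move=> p0 mf mg fg; rewrite unlock.
apply: gt0_ler_poweR; rewrite ?in_itv/= ?leey ?andbT.
- by rewrite invr_ge0 ltW.
- by apply: integral_ge0 => x _; rewrite lee_fin powR_ge0.
- by apply: integral_ge0 => x _; rewrite lee_fin powR_ge0.
apply: ge0_le_integral => //.
- exact: measurable_norm_powR.
- exact: measurable_norm_powR.
by move=> x _; rewrite lee_fin ge0_ler_powR ?nnegrE ?(ltW p0).
Qed.

Lemma Lnorm_le_add (p : R) f g h : 1 <= p ->
  measurable_fun [set: T] f -> measurable_fun [set: T] g ->
  measurable_fun [set: T] h ->
  (forall x, `|h x| <= `|f x + g x|) ->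
  (N p h <= N p f + N p g)%E.
Proof.
move=> p1 mf mg mh hfg.
apply: le_trans (minkowski_EFin mu mf mg p1).
apply: le_Lnorm => //; first exact: lt_le_trans p1.
exact: measurable_funD.
Qed.

(** One use of Minkowski shows that the norm of [h] is finite, so that [fine] does not collapse it
    to 0; two more give the two halves of the reverse triangle inequality. The pointwise hypothesis
    is what the moduli of two vectors and of their difference satisfy, so complex functions and
    gradients are treated alike. *)
Lemma dist_fine_Lnorm (p : R) f g h : 1 <= p ->
  measurable_fun [set: T] f -> measurable_fun [set: T] g ->
  measurable_fun [set: T] h ->
  (forall x, [/\ `|f x| <= `|g x + h x|, `|g x| <= `|f x + h x| &
                 `|h x| <= `|f x + g x|]) ->
  (N p f < +oo)%E -> (N p g < +oo)%E ->
  (N p h < +oo)%E /\ `|fine (N p f) - fine (N p g)| <= fine (N p h).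
Proof.
move=> p1 mf mg mh tri foo goo.
have hoo : (N p h < +oo)%E.
  apply: (@le_lt_trans _ _ (N p f + N p g)%E); last by rewrite lte_add_pinfty.
  by apply: Lnorm_le_add => // x; have [] := tri x.
split=> //.
have fin k : (N p k < +oo)%E -> (N p k = (fine (N p k))%:E)%E.
  by move=> koo; rewrite fineK// ge0_fin_numE// Lnorm_ge0.
have le3 (k1 k2 k : T -> R) : measurable_fun [set: T] k1 -> measurable_fun [set: T] k2 ->
    measurable_fun [set: T] k -> (forall x, `|k x| <= `|k1 x + k2 x|) ->
    (N p k1 < +oo)%E -> (N p k2 < +oo)%E -> (N p k < +oo)%E ->
    fine (N p k) <= fine (N p k1) + fine (N p k2).
  move=> mk1 mk2 mk kk /fin Ek1 /fin Ek2 /fin Ek.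
  by rewrite -lee_fin EFinD -Ek1 -Ek2 -Ek; exact: Lnorm_le_add.
have fgh : fine (N p f) <= fine (N p g) + fine (N p h).
  by apply: le3 => // x; have [] := tri x.
have gfh : fine (N p g) <= fine (N p f) + fine (N p h).
  by apply: le3 => // x; have [] := tri x.
by rewrite ler_norml; lra.
Qed.

Lemma fine_Lnorm_eq0 (p : R) f : 0 < p -> measurable_fun [set: T] f ->
  (N p f < +oo)%E -> fine (N p f) = 0 -> {ae mu, forall x, f x = 0}.
Proof.
move=> p0 mf foo f0.
(* Finiteness matters here: [fine] is also 0 at [+oo]. *)
have {}f0 : (N p f = 0)%E by rewrite -[LHS]fineK ?f0// ge0_fin_numE// Lnorm_ge0.
have mEf : measurable_fun [set: T] (fun x => (f x)%:E) by exact/measurable_EFinP.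
by apply: filterS (Lnorm_eq0_eq0 (p := p%:E) mEf _ f0) => // x /(_ I) [].
Qed.

Lemma ae_eq_Lnorm (p : R) f g :
  measurable_fun [set: T] f -> measurable_fun [set: T] g ->
  {ae mu, forall x, f x = g x} -> N p f = N p g.
Proof.
move=> mf mg fg; rewrite unlock; congr (_ `^ _)%E.
apply: ge0_ae_eq_integral => //.
- exact: measurable_norm_powR.
- exact: measurable_norm_powR.
- by move=> x _; exact: poweR_ge0.
- by move=> x _; exact: poweR_ge0.
by apply: filterS fg => x /= ->.
Qed.

End Lnorm.

(** * Triangle inequalities for the Euclidean norm, the complex modulus and the modulus of a
    gradient *)

Lemma sqrt_sum_sqrD (R : rcfType) (I : finType) (a b : I -> R) :
  Num.sqrt (\sum_i (a i + b i) ^+ 2) <=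
  Num.sqrt (\sum_i a i ^+ 2) + Num.sqrt (\sum_i b i ^+ 2).
Proof.
have sq0 (c : I -> R) : 0 <= \sum_i c i ^+ 2 by apply: sumr_ge0 => i _; exact: sqr_ge0.
have nul (c : I -> R) : Num.sqrt (\sum_i c i ^+ 2) = 0 -> forall i, c i = 0.
  move=> /eqP; rewrite sqrtr_eq0 => c0 i; apply/eqP; rewrite -sqrf_eq0.
  have /eqP : \sum_i c i ^+ 2 = 0 by apply/eqP; rewrite eq_le c0 sq0.
  rewrite psumr_eq0 => [/allP/(_ i)|j _]; last exact: sqr_ge0.
  by rewrite mem_index_enum; exact.
set A := Num.sqrt (\sum_i a i ^+ 2); set B := Num.sqrt (\sum_i b i ^+ 2).
(* The weights [B / A] and [A / B] used below make the final bound exactly [(A + B) ^ 2], but they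
   need both norms to be nonzero. *)
have [A0|A0] := eqVneq A 0.
  by rewrite A0 add0r; under eq_bigr do rewrite (nul a A0) add0r.
have [B0|B0] := eqVneq B 0.
  by rewrite B0 addr0; under eq_bigr do rewrite (nul b B0) addr0.
have A_gt0 : 0 < A by rewrite lt0r A0 sqrtr_ge0.
have B_gt0 : 0 < B by rewrite lt0r B0 sqrtr_ge0.
rewrite -(@ler_pXn2r _ 2) ?nnegrE ?sqrtr_ge0 ?addr_ge0 ?sqrtr_ge0//.
rewrite sqr_sqrtr//.
have AE : \sum_i a i ^+ 2 = A ^+ 2 by rewrite sqr_sqrtr.
have BE : \sum_i b i ^+ 2 = B ^+ 2 by rewrite sqr_sqrtr.
(* AM-GM: [2 a b <= (B / A) a^2 + (A / B) b^2] *)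
apply: (@le_trans _ _ ((1 + B / A) * \sum_i a i ^+ 2 +
                       (1 + A / B) * \sum_i b i ^+ 2)).
  rewrite !big_distrr/= -big_split/=; apply: ler_sum => i _.
  rewrite -subr_ge0.
  have -> : (1 + B / A) * a i ^+ 2 + (1 + A / B) * b i ^+ 2 - (a i + b i) ^+ 2
      = (B * a i - A * b i) ^+ 2 / (A * B).
    by field; rewrite A0 B0.
  by rewrite divr_ge0 ?sqr_ge0// mulr_ge0 ?ltW.
rewrite AE BE le_eqVlt; apply/orP; left; apply/eqP.
by field; rewrite A0 B0.
Qed.

Section gradmod.
Context {R : realType}.
Implicit Types (z w : R[i]) (g h : 'I_4 -> R4 R -> R[i]).

Local Notation normc := (@Normc.normc R).

Lemma normc_ge0 z : 0 <= normc z.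
Proof. by case: z => a b; exact: sqrtr_ge0. Qed.

Lemma normc_distC z w : normc (z - w) = normc (w - z).
Proof. by rewrite -opprB; exact: normcN. Qed.

Lemma le_normcB z w : normc z <= normc w + normc (z - w).
Proof. by have := le_normcD w (z - w); rewrite [_ + _]subrKC. Qed.

Lemma normcB_le z w : normc (z - w) <= normc z + normc w.
Proof. by rewrite -(normcN w); exact: le_normcD. Qed.

Lemma gradmod_ge0 g x : 0 <= gradmod g x.
Proof. exact: sqrtr_ge0. Qed.

Lemma gradmod_distC g h x :
  gradmod (fun j y => g j y - h j y) x = gradmod (fun j y => h j y - g j y) x.
Proof. by congr Num.sqrt; apply: eq_bigr => j _; rewrite normc_distC. Qed.

Lemma le_gradmodB g h x :
  gradmod g x <= gradmod h x + gradmod (fun j y => g j y - h j y) x.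
Proof.
apply: le_trans (sqrt_sum_sqrD _ _ _ _); apply: ler_wsqrtr.
apply: ler_sum => j _.
by rewrite ler_pXn2r ?nnegrE ?addr_ge0 ?normc_ge0//; exact: le_normcB.
Qed.

Lemma gradmodB_le g h x :
  gradmod (fun j y => g j y - h j y) x <= gradmod g x + gradmod h x.
Proof.
apply: le_trans (sqrt_sum_sqrD _ _ _ _); apply: ler_wsqrtr.
apply: ler_sum => j _.
by rewrite ler_pXn2r ?nnegrE ?addr_ge0 ?normc_ge0//; exact: normcB_le.
Qed.

End gradmod.

(** * Measurability of moduli of complex functions and of gradients *)

Section measurability.
Context {R : realType}.
Implicit Types (f : R4 R -> R[i]) (g h : 'I_4 -> R4 R -> R[i]).

Local Notation normc := (@Normc.normc R).

Lemma measurable_sqrtr : measurable_fun [set: R] (@Num.sqrt R).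
Proof. by apply: continuous_measurable_fun; exact: sqrt_continuous. Qed.

Lemma measurable_normc f : cmeasurable f ->
  measurable_fun [set: MR4 R] (fun x => normc (f x)).
Proof.
move=> [mRe mIm].
rewrite (_ : (fun x => _) = @Num.sqrt R \o
    (fun x => complex.Re (f x) ^+ 2 + complex.Im (f x) ^+ 2)); last first.
  by apply/funext => x /=; case: (f x).
apply: measurableT_comp; first exact: measurable_sqrtr.
by apply: measurable_funD; exact: measurable_funX.
Qed.

Lemma cmeasurableB f1 f2 : cmeasurable f1 -> cmeasurable f2 ->
  cmeasurable (fun x => f1 x - f2 x).
Proof.
move=> [mRe1 mIm1] [mRe2 mIm2]; split.
- rewrite (_ : (fun x => _) = (fun x => complex.Re (f1 x) - complex.Re (f2 x))).
    exact: measurable_funB.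
  by apply/funext => x; case: (f1 x) (f2 x) => ? ? [].
- rewrite (_ : (fun x => _) = (fun x => complex.Im (f1 x) - complex.Im (f2 x))).
    exact: measurable_funB.
  by apply/funext => x; case: (f1 x) (f2 x) => ? ? [].
Qed.

Lemma measurable_gradmod g : (forall j, cmeasurable (g j)) ->
  measurable_fun [set: MR4 R] (gradmod g).
Proof.
move=> mg; apply: (@measurableT_comp _ _ _ _ _ _ (@Num.sqrt R)).
  exact: measurable_sqrtr.
by apply: measurable_sum => j; apply: measurable_funX; exact: measurable_normc.
Qed.

Lemma gradmod_sqr g x : gradmod g x ^+ 2 = \sum_(j < 4) normc (g j x) ^+ 2.
Proof. by rewrite sqr_sqrtr// sumr_ge0// => j _; exact: sqr_ge0. Qed.

End measurability.

(** * Mass and energy in terms of norms *)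

Section norms.
Context {R : realType}.
Variable mu : {measure set (MR4 R) -> \bar R}.
Implicit Types (f : R4 R -> R[i]) (g h : 'I_4 -> R4 R -> R[i]).

Local Notation normc := (@Normc.normc R).
Local Notation N p f := (Lnorm mu p%:E (fun x => (f x)%:E)).

(** The squared norm is a sum of four integrals, each finite because the components are in L^2. *)
Lemma gradmod_L2 g : (forall j, Lp mu 2 (g j)) -> (N 2 (gradmod g) < +oo)%E.
Proof.
move=> Lg; apply: (@lty_poweRy _ _ 2) => //; rewrite Lnorm_powE//.
under eq_integral do
  rewrite ger0_norm ?gradmod_ge0// gradmod_sqr -sumEFin.
rewrite ge0_integral_sum//=.
- apply: lte_sum_pinfty => j _; have [mg goo] := Lg j.
  move: (poweR_lty 2 goo); rewrite Lnorm_powE//.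
  under eq_integral do rewrite ger0_norm ?normc_ge0//; exact: id.
- move=> j; apply/measurable_EFinP/measurable_funX.
  exact: measurable_normc _ (Lg j).1.
- by move=> j x _; rewrite lee_fin sqr_ge0.
Qed.

Lemma mass_ofE f : mass_of mu f = fine (LpNorm mu 2 f) ^+ 2.
Proof.
rewrite fine_Lnorm_exprn//; apply: eq_Rintegral => x _.
by rewrite ger0_norm// normc_ge0.
Qed.

(** Finite norms make both terms of the energy density integrable, so the integral of the difference
    splits. *)
Lemma energy_ofE f g :
  cmeasurable f -> (LpNorm mu 4 f < +oo)%E ->
  (forall j, cmeasurable (g j)) -> (N 2 (gradmod g) < +oo)%E ->
  energy_of mu f g = gradNorm mu g ^+ 2 / 2 - fine (LpNorm mu 4 f) ^+ 4 / 4.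
Proof.
move=> mf foo mg goo; rewrite /energy_of /gradNorm /LpNorm !fine_Lnorm_exprn//.
have If := Lnorm_lty_integrable _ _ _ mu 4 _ isT (measurable_normc _ mf) foo.
have Ig := Lnorm_lty_integrable _ _ _ mu 2 _ isT (measurable_gradmod _ mg) goo.
rewrite -!RintegralZr// -RintegralB//; last 2 first.
- rewrite (_ : _ \o _ = fun x => (`|gradmod g x| ^+ 2)%:E * 2^-1%:E)%E//.
  exact: integrableZr.
- rewrite (_ : _ \o _ = fun x => (`|normc (f x)| ^+ 4)%:E * 4^-1%:E)%E//.
  exact: integrableZr.
apply: eq_Rintegral => x _.
by rewrite !ger0_norm ?gradmod_ge0 ?normc_ge0.
Qed.

End norms.

(** * The ground state [W]: measurability, gradient and energy *)

Section ground_state.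
Context {R : realType}.

Lemma measurable_coord : [/\
  measurable_fun [set: MR4 R] (fun x => x.1.1.1 : measurableTypeR R),
  measurable_fun [set: MR4 R] (fun x => x.1.1.2 : measurableTypeR R),
  measurable_fun [set: MR4 R] (fun x => x.1.2 : measurableTypeR R) &
  measurable_fun [set: MR4 R] (fun x => x.2 : measurableTypeR R)].
Proof.
split; last exact: measurable_snd.
- exact: measurableT_comp measurable_fst
    (measurableT_comp measurable_fst measurable_fst).
- exact: measurableT_comp measurable_snd
    (measurableT_comp measurable_fst measurable_fst).
- exact: measurableT_comp measurable_snd measurable_fst.
Qed.

Lemma measurable_sqnorm : measurable_fun [set: MR4 R] (@sqnorm R).
Proof.
have [m1 m2 m3 m4] := measurable_coord.
apply: measurable_funD; last exact: measurable_funX.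
apply: measurable_funD; last exact: measurable_funX.
by apply: measurable_funD; exact: measurable_funX.
Qed.

Lemma sqnorm_ge0 (x : R4 R) : 0 <= sqnorm x.
Proof. by rewrite !addr_ge0 ?sqr_ge0. Qed.

Lemma measurable_W : measurable_fun [set: MR4 R] (@W R).
Proof.
rewrite (_ : @W R = (@powR R ^~ (-1)) \o (fun x => 1 + sqnorm x / 8)).
  apply: measurableT_comp => //; apply: measurable_funD => //.
  by apply: measurable_funM => //; exact: measurable_sqnorm.
by apply/funext => x /=; rewrite powR_inv1// addr_ge0// divr_ge0// sqnorm_ge0.
Qed.

Definition dotv (x y : R4 R) : R :=
  x.1.1.1 * y.1.1.1 + x.1.1.2 * y.1.1.2 + x.1.2 * y.1.2 + x.2 * y.2.

Lemma sqnormD (x v : R4 R) (t : R) :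
  sqnorm (t *: v + x) = sqnorm x + 2 * dotv x v * t + sqnorm v * t ^+ 2.
Proof.
case: x v => [[[a b] c] d] [[[a' b'] c'] d'].
rewrite /sqnorm /dotv /=.
rewrite -[t *: a']/(t * a') -[t *: b']/(t * b') -[t *: c']/(t * c').
rewrite -[t *: d']/(t * d').
ring.
Qed.

(** Along the line through [x] in direction [v], [W] is the inverse of a quadratic polynomial [q]
    with [q'(0) = dotv x v / 4]. The closed formula serves to show that the gradient of [W] is
    measurable. *)
Lemma partialW (j : 'I_4) (x : R4 R) :
  partial j W x = - (dotv x (unitvec j) / 4) * W x ^+ 2.
Proof.
set v := unitvec j.
(* Written with operations on functions, so that the derivative is found by instance inference. *)
pose q : R -> R := cst (1 + sqnorm x / 8) + (dotv x v / 4) *: id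
  + (sqnorm v / 8) *: (id ^+ 2).
have qE t : q t = 1 + sqnorm (t *: v + x) / 8.
  rewrite sqnormD /q.
  rewrite -[(_ + _) t]/(1 + sqnorm x / 8 + dotv x v / 4 * t
    + sqnorm v / 8 * (t * t)).
  by field.
have q0 : q 0 = 1 + sqnorm x / 8 by rewrite qE scale0r add0r.
have q0_neq0 : q 0 != 0.
  by rewrite q0 gt_eqF// ltr_pwDl// divr_ge0// sqnorm_ge0.
have dq : is_derive (0 : R) 1 q (dotv x v / 4).
  apply: is_derive_eq; rewrite /= -[_ *: _]/(_ * _).
  by rewrite expr1 mulr0 scale0r scaler0 addr0 add0r mulr1.
have -> : partial j W x = 'D_1 (fun t => (q t)^-1) (0 : R).
  rewrite /partial /derive.
  suff -> : (fun t : R => t^-1 *: ((W \o shift x) (t *: unitvec j) - W x)) =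
      (fun t : R => t^-1 *: (((fun t => (q t)^-1) \o shift 0) (t *: (1 : R))
        - (q 0)^-1)) by [].
  apply/funext => t /=.
  by rewrite !qE /W addr0 scale0r add0r -[t *: 1]/(t * 1) mulr1.
have dV := is_deriveV q0_neq0 dq.
rewrite derive_val q0 /W -[_ *: _]/(_ * _) exprVn.
ring.
Qed.

Lemma cmeasurable_Wc : cmeasurable (@Wc R).
Proof. by split; [exact: measurable_W|exact: measurable_cst]. Qed.

Lemma cmeasurable_gradW j : cmeasurable (@gradW R j).
Proof.
split=> /=; last exact: measurable_cst.
rewrite (_ : (fun x => _) = fun x => - (dotv x (unitvec j) / 4) * W x ^+ 2).
  apply: measurable_funM; last first.
    by apply: measurable_funX; exact: measurable_W.
  apply: measurable_funN; apply: measurable_funM => //.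
  have [m1 m2 m3 m4] := measurable_coord.
  apply: measurable_funD; last exact: measurable_funM.
  apply: measurable_funD; last exact: measurable_funM.
  by apply: measurable_funD; exact: measurable_funM.
by apply/funext => x; exact: partialW.
Qed.

Lemma W_energyE : W_dotH1 != 0 :> R -> W_L4 != 0 :> R ->
  W_energy = W_dotH1 ^+ 2 / 2 - W_L4 ^+ 4 / 4 :> R.
Proof.
move=> W2 W4; apply: energy_ofE.
- exact: cmeasurable_Wc.
- by rewrite ltey; apply: contra_neq W4 => W4; rewrite /W_L4 W4.
- exact: cmeasurable_gradW.
- by rewrite ltey; apply: contra_neq W2 => W2; rewrite /W_dotH1 /gradNorm W2.
Qed.

End ground_state.

(** * Functionals on H^1 and their dependence on the H^1 distance *)

Section H1_functionals.
Context {R : realType}.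
Implicit Types f g : H1 R.

Local Notation normc := (@Normc.normc R).
Local Notation N p f := (Lnorm muRT3 p%:E (fun x => (f x)%:E)).

Lemma L2_lty f : (LpNorm muRT3 2 f < +oo)%E.
Proof. exact: (sob_fun_Lp f).2. Qed.

Lemma cmeasurable_sob f : cmeasurable f.
Proof. exact: (sob_fun_Lp f).1. Qed.

Lemma cmeasurable_sob_grad f j : cmeasurable (sob_grad f j).
Proof. exact: (sob_grad_L2 f j).1. Qed.

Lemma sob_grad_lty f : (N 2 (gradmod (sob_grad f)) < +oo)%E.
Proof. by apply: gradmod_L2; exact: sob_grad_L2. Qed.

Lemma dotH1_ge0 f : 0 <= dotH1 f.
Proof. exact/fine_ge0/Lnorm_ge0. Qed.

Lemma L2_dist f g : (LpNorm muRT3 2 (fun x => (f x - g x)%R) < +oo)%E /\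
  `|L2 f - L2 g| <= fine (LpNorm muRT3 2 (fun x => f x - g x)).
Proof.
apply: dist_fine_Lnorm; rewrite ?ler1n//.
- exact: measurable_normc _ (cmeasurable_sob f).
- exact: measurable_normc _ (cmeasurable_sob g).
- exact: measurable_normc _
    (cmeasurableB _ _ (cmeasurable_sob f) (cmeasurable_sob g)).
- move=> x; rewrite !ger0_norm ?addr_ge0 ?normc_ge0//; split.
  + exact: le_normcB.
  + by rewrite normc_distC; exact: le_normcB.
  + exact: normcB_le.
- exact: L2_lty.
- exact: L2_lty.
Qed.

Lemma dotH1_dist f g : `|dotH1 f - dotH1 g| <=
  gradNorm muRT3 (fun j x => sob_grad f j x - sob_grad g j x).
Proof.
set h := fun j x => _; suff [] : (N 2 (gradmod h) < +oo)%E /\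
  `|dotH1 f - dotH1 g| <= gradNorm muRT3 h by [].
apply: dist_fine_Lnorm; rewrite ?ler1n//.
- exact: measurable_gradmod _ (cmeasurable_sob_grad f).
- exact: measurable_gradmod _ (cmeasurable_sob_grad g).
- exact: measurable_gradmod _ (fun j => cmeasurableB _ _
    (cmeasurable_sob_grad f j) (cmeasurable_sob_grad g j)).
- move=> x; rewrite !ger0_norm ?addr_ge0 ?gradmod_ge0//; split.
  + exact: le_gradmodB.
  + by rewrite gradmod_distC; exact: le_gradmodB.
  + exact: gradmodB_le.
- exact: sob_grad_lty.
- exact: sob_grad_lty.
Qed.

Lemma L2_dist_H1dist f g : `|L2 f - L2 g| <= H1dist f g.
Proof.
apply: le_trans (L2_dist f g).2 _.
rewrite -[leLHS]ger0_norm ?fine_ge0 ?Lnorm_ge0// -sqrtr_sqr.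
by rewrite ler_wsqrtr// lerDl sqr_ge0.
Qed.

Lemma dotH1_dist_H1dist f g : `|dotH1 f - dotH1 g| <= H1dist f g.
Proof.
apply: le_trans (dotH1_dist f g) _.
rewrite -[leLHS]ger0_norm ?fine_ge0 ?Lnorm_ge0// -sqrtr_sqr.
by rewrite ler_wsqrtr// lerDr sqr_ge0.
Qed.

(** Distance 0 means equality almost everywhere, which the L^4 norm cannot detect. This is needed
    because the initial condition only says that [u 0] is at distance 0 from [u0]. *)
Lemma H1dist0_L4 f g : H1dist f g = 0 -> L4 f = L4 g.
Proof.
move=> /eqP; rewrite sqrtr_eq0 => fg0.
have /eqP : fine (LpNorm muRT3 2 (fun x => f x - g x)) ^+ 2 = 0.
  apply/eqP; rewrite eq_le sqr_ge0 andbT.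
  by apply: le_trans fg0; rewrite lerDl sqr_ge0.
rewrite sqrf_eq0 => /eqP N0.
have mfg := cmeasurableB _ _ (cmeasurable_sob f) (cmeasurable_sob g).
have ae0 := fine_Lnorm_eq0 _ _ _ _ _ _ (ltr0n _ 2)
  (measurable_normc _ mfg) (L2_dist f g).1 N0.
congr fine; apply: ae_eq_Lnorm.
- exact: measurable_normc _ (cmeasurable_sob f).
- exact: measurable_normc _ (cmeasurable_sob g).
by apply: filterS ae0 => x /Normc.eq0_normc /eqP; rewrite subr_eq0 => /eqP ->.
Qed.

Lemma massE f : mass f = L2 f ^+ 2.
Proof. exact: mass_ofE. Qed.

(** * Consequences of the embedding of H^1 into L^4 *)

Section embedding.
Variables C4 c : R.
Hypothesis emb : @H1_L4_bound R C4 c.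

(** The embedding is an inequality of extended reals with a real right-hand side, which excludes
    [+oo] on the left. *)
Lemma L4_lty f : (LpNorm muRT3 4 f < +oo)%E.
Proof.
by have := emb f; rewrite !ltey; apply: contraTN => /eqP ->.
Qed.

Lemma L4_le f : 0 <= c ->
  L4 f ^+ 4 <= C4 ^+ 4 * (dotH1 f ^+ 2 + c * L2 f ^+ 2) ^+ 2.
Proof.
move=> c0; have := emb f.
rewrite -[LpNorm _ _ _]fineK ?ge0_fin_numE ?L4_lty ?Lnorm_ge0//.
rewrite -EFin_expe lee_fin -/(L4 f) => Lle.
rewrite (exprM _ 2 2) [C4 ^+ 4](exprM _ 2 2) -exprMn.
rewrite ler_pXn2r ?nnegrE ?sqr_ge0// mulr_ge0 ?sqr_ge0//.
by rewrite addr_ge0 ?sqr_ge0// mulr_ge0 ?sqr_ge0.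
Qed.

Lemma energyE f : energy f = dotH1 f ^+ 2 / 2 - L4 f ^+ 4 / 4.
Proof.
apply: energy_ofE.
- exact: cmeasurable_sob.
- exact: L4_lty.
- exact: cmeasurable_sob_grad.
- exact: sob_grad_lty.
Qed.

Lemma H1star_sqr f : 0 <= c -> H1star c f ^+ 2 = dotH1 f ^+ 2 + c * L2 f ^+ 2.
Proof. by move=> c0; rewrite sqr_sqrtr// addr_ge0 ?sqr_ge0// mulr_ge0 ?sqr_ge0. Qed.

(** Writes [Estar] through the two conserved quantities, so that it is conserved as well. *)
Lemma EstarE f : 0 <= c -> Estar c f = energy f + c / 2 * mass f.
Proof. by move=> c0; rewrite /Estar H1star_sqr// energyE massE; field. Qed.

End embedding.

Lemma H1dist0_functionals f g : H1dist f g = 0 ->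
  [/\ dotH1 f = dotH1 g, L2 f = L2 g & L4 f = L4 g].
Proof.
move=> fg; split; last exact: H1dist0_L4.
- by apply/eqP; rewrite -subr_eq0 -normr_le0 -fg dotH1_dist_H1dist.
- by apply/eqP; rewrite -subr_eq0 -normr_le0 -fg L2_dist_H1dist.
Qed.

Lemma H1dist_cvg (F : H1 R -> R) (u : R -> H1 R) (t : R) :
  (forall f g, `|F f - F g| <= H1dist f g) ->
  (fun s => H1dist (u s) (u t)) @ t --> (0 : R) ->
  (fun s => F (u s)) @ t --> F (u t).
Proof.
move=> Fd /cvgr0_norm_lt ut0; apply/cvgrPdist_lt => e e0.
near=> s; rewrite distrC; apply: le_lt_trans (Fd _ _) _.
rewrite -[ltLHS]ger0_norm ?sqrtr_ge0//.
by near: s; exact: ut0.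
Unshelve. all: by end_near. Qed.

End H1_functionals.

(** * The continuity argument for a real function on an interval *)

Section trapping.
Context {R : realType}.

(** Otherwise the intermediate value theorem on the segment between 0 and [t], which lies in [I],
    produces a time at which the value is [v]. *)
Lemma stays_below (I : set R) (y : R -> R) (v : R) :
  is_interval I -> I 0 -> (forall t, I t -> y @ t --> y t) ->
  (forall t, I t -> y t != v) -> y 0 < v -> forall t, I t -> y t < v.
Proof.
move=> itvI I0 yc yv y0 t It; rewrite ltNge; apply/negP => vt.
(* Symmetric in the endpoint values, so that it covers both [t >= 0] and [t < 0]. *)
have ivt a b : I a -> I b -> a <= b ->
    Num.min (y a) (y b) <= v <= Num.max (y a) (y b) -> False.
  move=> Ia Ib ab vab; have Iab x : x \in `[a, b] -> I x.
    by rewrite in_itv/= => xab; exact: itvI xab.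
  have [|c cab yc1] := IVT ab _ vab; last first.
    by move: (yv c (Iab c cab)); rewrite yc1 eqxx.
  by apply: continuous_in_subspaceT => x; rewrite inE => /Iab/yc.
have [t0|t0] := leP 0 t.
- by apply: (ivt 0 t I0 It t0); rewrite ge_min (ltW y0) le_max vt orbT.
- apply: (ivt t 0 It I0 (ltW t0)).
  by rewrite ge_min (ltW y0) orbT le_max vt.
Qed.

(* [1 - (1 - K y)^2 = 4 K (y / 2 - K y^2 / 4)]. *)
Lemma energy_gap (K d0 y E : R) : 0 < K ->
  y / 2 - K * y ^+ 2 / 4 <= E -> E < (1 - d0) * (K^-1 / 4) ->
  d0 < (1 - K * y) ^+ 2.
Proof.
move=> K0 yE EK.
have : (y / 2 - K * y ^+ 2 / 4) * (4 * K) < (1 - d0) * (K^-1 / 4) * (4 * K).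
  by rewrite ltr_pM2r ?mulr_gt0//; exact: le_lt_trans EK.
have -> : (1 - d0) * (K^-1 / 4) * (4 * K) = 1 - d0.
  by field; rewrite gt_eqF.
nra.
Qed.

Lemma trapping (K d0 : R) (I : set R) (y : R -> R) : 0 < K -> 0 < d0 ->
  is_interval I -> I 0 -> (forall t, I t -> y @ t --> y t) -> K * y 0 < 1 ->
  (forall t, I t -> K * y t <= 1 -> d0 < (1 - K * y t) ^+ 2) ->
  forall t, I t -> K * y t < 1 - Num.sqrt d0.
Proof.
move=> K0 d00 itvI I0 yc y0 ygap t It.
have Kyt : K * y t < 1.
  apply: (@stays_below I (fun t => K * y t)) => // s Is; first by
    apply: cvgM; [exact: cvg_cst|exact: yc].
  (* At the value 1 the gap condition would read [d0 < 0]. *)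
  apply/negP => /eqP Kys; have := ygap s Is.
  by rewrite Kys subrr expr0n/= lexx ltNge (ltW d00) => /(_ isT).
have := ygap t It (ltW Kyt).
rewrite -{1}(sqr_sqrtr (ltW d00)) ltr_pXn2r ?nnegrE ?sqrtr_ge0 ?subr_ge0 ?ltW//.
by lra.
Qed.

End trapping.

(** * Conservation laws and trapping along a maximal solution *)

Section dynamics.
Context {R : realType}.

Lemma ground_state_values (C4 : R) :
  W_dotH1 ^+ 2 = C4 ^- 4 /\ W_L4 ^+ 4 = C4 ^- 4 -> 0 < W_dotH1 :> R ->
  0 < C4 ^+ 4 /\ W_energy = C4 ^- 4 / 4.
Proof.
move=> [W2 W4] W0.
(* This excludes [C4 = 0], for which the inverse power is 0 by convention. *)
have CV0 : 0 < C4 ^- 4 by rewrite -W2 exprn_gt0.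
have W40 : W_L4 != 0 :> R.
  by apply: contraTneq CV0 => W40; rewrite -W4 W40 expr0n ltxx.
split; first by rewrite -invr_gt0.
by rewrite W_energyE ?(gt_eqF W0)// W2 W4; lra.
Qed.

Variables (C4 c : R).
Hypothesis c_ge0 : 0 <= c.
Hypothesis emb : @H1_L4_bound R C4 c.
Variables (u0 : H1 R) (I : set R) (u : R -> H1 R).
Hypothesis solu : is_maximal_solution u0 I u.

Lemma L2_const t : I t -> L2 (u t) = L2 (u 0).
Proof.
case: solu => -[_ _ _ _ cons] _ _ /cons[+ _].
rewrite !massE => /eqP; rewrite eqrXn2 ?fine_ge0 ?Lnorm_ge0//.
by move/eqP.
Qed.

Lemma Estar_const t : I t -> Estar c (u t) = Estar c u0.
Proof.
case: (solu) => -[_ _ _ _ cons] u00 _ /cons[ut0 et0].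
rewrite (EstarE _ _ emb)// ut0 et0 -(EstarE _ _ emb)//.
by rewrite /Estar /H1star; have [-> -> ->] := H1dist0_functionals _ _ u00.
Qed.

Lemma Estarstar_const t : I t -> Estarstar C4 c (u t) = Estarstar C4 c u0.
Proof.
move=> It; rewrite /Estarstar Estar_const// L2_const//.
by case: solu => _ /H1dist0_functionals[_ ->].
Qed.

Lemma dotH1_cvg t : I t -> (fun s => dotH1 (u s)) @ t --> dotH1 (u t).
Proof.
case: solu => -[_ _ cu _ _] _ _ It.
by apply: H1dist_cvg (cu _ It); exact: dotH1_dist_H1dist.
Qed.

Lemma L2_cvg t : I t -> (fun s => L2 (u s)) @ t --> L2 (u t).
Proof.
case: solu => -[_ _ cu _ _] _ _ It.
by apply: H1dist_cvg (cu _ It); exact: L2_dist_H1dist.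
Qed.

Lemma trapping_H1star (delta0 : R) :
  W_dotH1 ^+ 2 = C4 ^- 4 /\ W_L4 ^+ 4 = C4 ^- 4 -> 0 < delta0 ->
  H1star c u0 < W_dotH1 -> Estar c u0 < (1 - delta0) * W_energy ->
  forall t, I t -> 0 < C4 ^+ 4 /\
    C4 ^+ 4 * H1star c (u t) ^+ 2 < 1 - Num.sqrt delta0.
Proof.
move=> hW d0 u0W E0 t It.
(* A nonnegative norm lies strictly below [W_dotH1], which is therefore positive. *)
have [K0 WE] := ground_state_values _ hW (le_lt_trans (sqrtr_ge0 _) u0W).
split=> //.
case: (solu) => -[[_ itvI] I0 _ _ _] u00 _.
apply: (@trapping _ _ _ I (fun t => H1star c (u t) ^+ 2)) => // [s Is||s Is _].
(* The squared norm is a combination of squares of two continuous norms; no square root is left. *)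
- under eq_fun do rewrite H1star_sqr//; rewrite H1star_sqr//.
  apply: cvgD; first by rewrite expr2; under eq_fun do rewrite expr2;
    apply: cvgM; exact: dotH1_cvg.
  apply: cvgM; first exact: cvg_cst.
  by rewrite expr2; under eq_fun do rewrite expr2; apply: cvgM; exact: L2_cvg.
- have -> : H1star c (u 0) = H1star c u0.
    by rewrite /H1star; have [-> -> _] := H1dist0_functionals _ _ u00.
  rewrite mulrC -ltr_pdivlMr// div1r -hW.1.
  by rewrite ltr_pXn2r ?nnegrE ?sqrtr_ge0// (le_trans _ (ltW u0W)) ?sqrtr_ge0.
- apply: (energy_gap _ _ _ (Estar c (u s))); rewrite -?WE ?Estar_const//.
  rewrite -(Estar_const _ Is) /Estar.
  have := L4_le _ _ emb (u s) c_ge0; rewrite -H1star_sqr//.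
  by lra.
Qed.

(** Put [n = L2 ^ 2]. The embedding gives [L4 ^ 4 <= K * (y + c * n) ^ 2]. The quartic term of
    [Estarstar] cancels the contribution of [n ^ 2], which leaves [y / 2 - K * y ^ 2 / 4] plus
    [c * n * (1 - K * y) / 2]. *)
Lemma trapping_dotH1 (delta0 : R) :
  W_dotH1 ^+ 2 = C4 ^- 4 /\ W_L4 ^+ 4 = C4 ^- 4 -> 0 < delta0 ->
  dotH1 u0 < W_dotH1 -> Estarstar C4 c u0 < (1 - delta0) * W_energy ->
  forall t, I t -> 0 < C4 ^+ 4 /\
    C4 ^+ 4 * dotH1 (u t) ^+ 2 < 1 - Num.sqrt delta0.
Proof.
move=> hW d0 u0W E0 t It.
have [K0 WE] := ground_state_values _ hW (le_lt_trans (dotH1_ge0 _) u0W).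
split=> //.
case: (solu) => -[[_ itvI] I0 _ _ _] u00 _.
apply: (@trapping _ _ _ I (fun t => dotH1 (u t) ^+ 2)) => // [s Is||s Is Ks].
- by rewrite expr2; under eq_fun do rewrite expr2; apply: cvgM;
    exact: dotH1_cvg.
- have [-> _ _] := H1dist0_functionals _ _ u00.
  rewrite mulrC -ltr_pdivlMr// div1r -hW.1.
  by rewrite ltr_pXn2r ?nnegrE ?dotH1_ge0// (le_trans _ (ltW u0W)) ?dotH1_ge0.
- apply: (energy_gap _ _ _ (Estarstar C4 c (u s))); rewrite -?WE ?Estarstar_const//.
  rewrite -(Estarstar_const _ Is) /Estarstar /Estar H1star_sqr//.
  have := L4_le _ _ emb (u s) c_ge0.
  (* Twice the leftover term; its sign is where [K * y <= 1] enters. *)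
  have : 0 <= c * L2 (u s) ^+ 2 * (1 - C4 ^+ 4 * dotH1 (u s) ^+ 2).
    by rewrite mulr_ge0 ?subr_ge0// mulr_ge0// sqr_ge0.
  rewrite (exprM (L2 (u s)) 2 2).
  by lra.
Qed.

End dynamics.

(** * From the trapping bounds to the coercivity estimates *)

Theorem theorem3p7 (R : realType) (C4 cs : R)
  (hC4 : best_sobolev_constant C4)
  (hW : W_dotH1 ^+ 2 = C4 ^- 4 /\ W_L4 ^+ 4 = C4 ^- 4)
  (hcs : 0 < cs)
  (hemb : H1_L4_bound C4 cs) :
  (forall delta0 : R, 0 < delta0 -> exists delta : R, 0 < delta /\
     forall (u0 : H1 R) (I : set R) (u : R -> H1 R),
       is_maximal_solution u0 I u ->
       H1star cs u0 < W_dotH1 ->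
       Estar cs u0 < (1 - delta0) * W_energy ->
       forall t : R, I t ->
         [/\ H1star cs (u t) ^+ 2 < (1 - delta) * W_dotH1 ^+ 2,
             delta * H1star cs (u t) ^+ 2
               <= H1star cs (u t) ^+ 2 - L4 (u t) ^+ 4 &
             (1 + delta) / 4 * H1star cs (u t) ^+ 2 <= Estar cs (u t)])
  /\
  (forall delta0 : R, 0 < delta0 -> exists delta : R, 0 < delta /\
     forall (u0 : H1 R) (I : set R) (u : R -> H1 R),
       is_maximal_solution u0 I u ->
       dotH1 u0 < W_dotH1 ->
       Estarstar C4 cs u0 < (1 - delta0) * W_energy ->
       forall t : R, I t ->
         [/\ dotH1 (u t) ^+ 2 < (1 - delta) * W_dotH1 ^+ 2,
             delta * dotH1 (u t) ^+ 2
               <= dotH1 (u t) ^+ 2 - L4 (u t) ^+ 4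
                  + 2 * cs * L2 (u t) ^+ 2
                  + cs ^+ 2 * C4 ^+ 4 * L2 (u t) ^+ 4 &
             (1 + delta) / 4 * dotH1 (u t) ^+ 2 <= Estarstar C4 cs (u t)]).
Proof.
have cs0 := ltW hcs.
split=> delta0 d0; exists (Num.sqrt delta0); split; rewrite ?sqrtr_gt0//.
  move=> u0 I u solu u0W E0 t It.
  have [K0] := trapping_H1star _ _ cs0 hemb _ _ _ solu _ hW d0 u0W E0 _ It.
  have := L4_le _ _ hemb (u t) cs0; rewrite -H1star_sqr// /Estar.
  set y := H1star cs (u t) ^+ 2; set m := L4 (u t) ^+ 4.
  have y0 : 0 <= y by exact: sqr_ge0.
  set d := Num.sqrt delta0; move=> my yd.
  (* From [m <= K * y ^ 2] and [K * y < 1 - d], hence [m <= (1 - d) * y]. *)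
  have dy : d * y <= y - m.
    have : 0 <= y * (1 - d - C4 ^+ 4 * y) by rewrite mulr_ge0// subr_ge0 ltW.
    by lra.
  (* [Estar] is [y / 4 + (y - m) / 4]. *)
  split=> //; last by lra.
  by rewrite hW.1 ltr_pdivlMr// mulrC.
move=> u0 I u solu u0W E0 t It.
have [K0] := trapping_dotH1 _ _ cs0 hemb _ _ _ solu _ hW d0 u0W E0 _ It.
have := L4_le _ _ hemb (u t) cs0; rewrite /Estarstar /Estar H1star_sqr//.
set y := dotH1 (u t) ^+ 2; set m := L4 (u t) ^+ 4.
rewrite (exprM (L2 (u t)) 2 2); set n := L2 (u t) ^+ 2.
have y0 : 0 <= y by exact: sqr_ge0.
have n0 : 0 <= n by exact: sqr_ge0.
set d := Num.sqrt delta0; move=> my yd.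
have d_ge0 : 0 <= d by exact: sqrtr_ge0.
(* After the embedding and cancellation of [n ^ 2], the right-hand side is at least [y * (1 - K * y)
   + 2 * cs * n * (1 - K * y)]; the first term is at least [d * y], the second is nonnegative. *)
have dy : d * y <= y - m + 2 * cs * n + cs ^+ 2 * C4 ^+ 4 * n ^+ 2.
  have : 0 <= y * (1 - d - C4 ^+ 4 * y) by rewrite mulr_ge0// subr_ge0 ltW.
  have : 0 <= cs * n * (1 - C4 ^+ 4 * y).
    by apply: mulr_ge0; [exact: mulr_ge0|lra].
  by lra.
(* [Estarstar] is [y / 4] plus a quarter of the right-hand side of [dy]. *)
split=> //; last by lra.
by rewrite hW.1 ltr_pdivlMr// mulrC.
Qed.
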